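(* The algebra $\mathfrak{pvb}_n^!$ has a basis consisting exactly of the monomials corresponding to chain gangs on $[n]=\{1,\dots,n\}$; that is, for each unordered partition of $[n]$ into nonempty linearly ordered subsets (chains) $(a_1,\dots,a_s)$, the element $\bigwedge_{\text{chains}} (r_{a_1a_2}\wedge r_{a_2a_3}\wedge\cdots\wedge r_{a_{s-1}a_s})$ (a chain of length one contributing the empty product), and these elements (each determined up to sign) form a basis.
   Context: $\mathfrak{pvb}_n^!$ is the graded $\mathbb{Q}$-algebra obtained as the quotient of the exterior algebra on degree-1 generators $r_{ij}$, $1\le i\ne j\le n$, by the ideal generated by $r_{ij}\wedge r_{ik}=r_{ij}\wedge r_{jk}-r_{ik}\wedge r_{kj}$, $r_{ik}\wedge r_{jk}=r_{ij}\wedge r_{jk}-r_{ji}\wedge r_{ik}$ (for $i,j,k$ distinct) and $r_{ij}\wedge r_{ji}=0$. A monomial $r_{i_1j_1}\wedge\cdots\wedge r_{i_mj_m}$ corresponds to the directed graph on vertex set $[n]$ with edges $(i_1,j_1),\dots,(i_m,j_m)$; a chain gang is the graph formed by directed paths $a_1\to a_2\to\cdots\to a_s$ over the blocks of an unordered partition of $[n]$ into ordered subsets. *)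

(* Defs.v *)
From HB Require Import structures.
From mathcomp Require Import all_boot all_order all_algebra.
Set Implicit Arguments. Unset Strict Implicit. Unset Printing Implicit Defensive.
Import Order.TTheory GRing.Theory Num.Theory.
Local Open Scope ring_scope.

Section PVB.
Variable n : nat.
Local Notation ext := ({ffun {set {p : 'I_n * 'I_n | p.1 != p.2}} -> rat^o}).

Definition edge := {p : 'I_n * 'I_n | p.1 != p.2}.

(* The exterior algebra over Q on the generators: an element is a coefficient
   function on the basis monomials e_S (S a set of generators), where e_S is the
   wedge of the generators of S taken in increasing order of enum_rank. *)

Definition ebasis (S : {set edge}) : ext := [ffun T => (T == S)%:R].

Definition esgn (S T : {set edge}) : rat :=
  (-1) ^+ #|[set p : edge * edge | [&& p.1 \in S, p.2 \in T &
                                       (enum_rank p.2 < enum_rank p.1)%N]]|.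

Definition ewedge_basis (S T : {set edge}) : ext :=
  if [disjoint S & T] then esgn S T *: ebasis (S :|: T) else 0.

Definition ewedge (x y : ext) : ext :=
  \sum_(S : {set edge}) \sum_(T : {set edge}) (x S * y T) *: ewedge_basis S T.

(* the generator r_ij (0 if i = j, never used in that case) *)
Definition rgen (i j : 'I_n) : ext :=
  if insub (i, j) is Some g then ebasis [set g] else 0.

Definition prel (ijk : 'I_n * 'I_n * 'I_n) (t : 'I_3) : ext :=
  let: (i, j, k) := ijk in
  if (val t == 2)%N then (if i != j then ewedge (rgen i j) (rgen j i) else 0)
  else if [&& i != j, j != k & i != k] then
    (if (val t == 0)%N then
       ewedge (rgen i j) (rgen i k)
       - (ewedge (rgen i j) (rgen j k) - ewedge (rgen i k) (rgen k j))
     else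
       ewedge (rgen i k) (rgen j k)
       - (ewedge (rgen i j) (rgen j k) - ewedge (rgen j i) (rgen i k)))
  else 0.

Definition in_pideal (x : ext) : Prop :=
  exists c : {ffun ('I_n * 'I_n * 'I_n * 'I_3) * {set edge} * {set edge} -> rat},
    x = \sum_(k : ('I_n * 'I_n * 'I_n * 'I_3) * {set edge} * {set edge})
          c k *: ewedge (ewedge (ebasis k.1.2) (prel k.1.1.1 k.1.1.2)) (ebasis k.2).

(* Chain gangs: an unordered partition of [n] into nonempty ordered subsets
   (chains), represented by a list of chains (the list order is irrelevant). *)
Definition is_chain_gang (cs : seq (seq 'I_n)) : bool :=
  all (fun c => c != [::]) cs && perm_eq (flatten cs) (enum 'I_n).

Definition chain_gang_edges (cs : seq (seq 'I_n)) : {set edge} :=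
  [set g : edge | val g \in flatten [seq zip c (behead c) | c <- cs]].

Definition chain_gang_graph (S : {set edge}) : Prop :=
  exists cs, is_chain_gang cs /\ chain_gang_edges cs = S.

End PVB.

Notation ext n := ({ffun {set edge n} -> rat^o}).

(* Main.v *)
Require Import Defs.
From HB Require Import structures.
From mathcomp Require Import all_boot all_order all_algebra.
From mathcomp Require Import zify.
Import GRing.Theory.
Set Implicit Arguments. Unset Strict Implicit. Unset Printing Implicit Defensive.
Local Open Scope ring_scope.

(* Spanning: multiplying a chain gang by r_ij either joins two chains or adds a
   chord or a backward edge to one of them. In the first case the relations
   rewrite the resulting tree as a combination of paths, shuffling the branches;
   in the second case they shorten the cycle until r_ij r_ji = 0 or r_ij^2 = 0.

   Independence: for a chain gang P write i <= j when j is reachable from i in P,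
   and choose h_i of degree 1 with h_j - h_i = r_ij for every edge of P. Sending
   r_ij to h_j - h_i when i <= j and to 0 otherwise kills the relations, because
   (y - x)(z - x) = (y - x)(z - y) = (z - x)(z - y) for x, y, z of degree 1. This
   endomorphism of the exterior algebra fixes the monomial of P and kills the
   monomial of every graph with an edge outside the order of P. A chain gang is
   determined by its reachability relation, so a nonzero coefficient with fewest
   reachable pairs cannot occur in a combination lying in the ideal. *)

(** * The exterior algebra *)

Lemma ewedge_basisE n (S T : {set edge n}) :
  ewedge (ebasis S) (ebasis T) = ewedge_basis S T.
Proof.
rewrite /ewedge (bigD1 S) //= [X in _ + X]big1 ?addr0 => [|U US].
  rewrite (bigD1 T) //= [X in _ + X]big1 ?addr0 => [|U UT].
    by rewrite !ffunE !eqxx mulr1 scale1r.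
  by rewrite !ffunE (negbTE UT) mulr0 scale0r.
by rewrite big1 // => V _; rewrite !ffunE (negbTE US) mul0r scale0r.
Qed.

Lemma ext_ebasis n (x : ext n) : x = \sum_(S : {set edge n}) x S *: ebasis S.
Proof.
apply/ffunP => T; rewrite sum_ffunE (bigD1 T) //= big1 ?addr0 => [|S ST].
  by rewrite !ffunE eqxx /GRing.scale /= mulr1.
by rewrite !ffunE eq_sym (negbTE ST) /GRing.scale /= mulr0.
Qed.

Lemma ewedgeDl n (x y z : ext n) : ewedge (x + y) z = ewedge x z + ewedge y z.
Proof.
rewrite /ewedge -big_split; apply: eq_bigr => S _ /=.
by rewrite -big_split; apply: eq_bigr => T _ /=; rewrite ffunE mulrDl scalerDl.
Qed.

Lemma ewedgeDr n (x y z : ext n) : ewedge z (x + y) = ewedge z x + ewedge z y.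
Proof.
rewrite /ewedge -big_split; apply: eq_bigr => S _ /=.
by rewrite -big_split; apply: eq_bigr => T _ /=; rewrite ffunE mulrDr scalerDl.
Qed.

Lemma ewedgeZl n (a : rat) (x z : ext n) : ewedge (a *: x) z = a *: ewedge x z.
Proof.
rewrite /ewedge scaler_sumr; apply: eq_bigr => S _.
by rewrite scaler_sumr; apply: eq_bigr => T _; rewrite ffunE scalerA mulrA.
Qed.

Lemma ewedgeZr n (a : rat) (x z : ext n) : ewedge z (a *: x) = a *: ewedge z x.
Proof.
rewrite /ewedge scaler_sumr; apply: eq_bigr => S _.
rewrite scaler_sumr; apply: eq_bigr => T _.
by rewrite ffunE scalerA /GRing.scale /= mulrCA.
Qed.

Lemma ewedge0x n (z : ext n) : ewedge 0 z = 0.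
Proof. by rewrite -[X in ewedge X _](scale0r 0) ewedgeZl scale0r. Qed.

Lemma ewedgex0 n (z : ext n) : ewedge z 0 = 0.
Proof. by rewrite -[X in ewedge _ X](scale0r 0) ewedgeZr scale0r. Qed.

Lemma ewedgeNl n (x z : ext n) : ewedge (- x) z = - ewedge x z.
Proof. by rewrite -scaleN1r ewedgeZl scaleN1r. Qed.

Lemma ewedgeNr n (x z : ext n) : ewedge z (- x) = - ewedge z x.
Proof. by rewrite -scaleN1r ewedgeZr scaleN1r. Qed.

Lemma ewedgeBl n (x y z : ext n) : ewedge (x - y) z = ewedge x z - ewedge y z.
Proof. by rewrite ewedgeDl ewedgeNl. Qed.

Lemma ewedge_suml n I (r : seq I) (P : pred I) (E : I -> ext n) z :
  ewedge (\sum_(i <- r | P i) E i) z = \sum_(i <- r | P i) ewedge (E i) z.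
Proof.
by elim/big_rec2: _ => [|i x y _ <-]; rewrite ?ewedgeDl ?ewedge0x.
Qed.

Lemma ewedge_sumr n I (r : seq I) (P : pred I) (E : I -> ext n) z :
  ewedge z (\sum_(i <- r | P i) E i) = \sum_(i <- r | P i) ewedge z (E i).
Proof.
by elim/big_rec2: _ => [|i x y _ <-]; rewrite ?ewedgeDr ?ewedgex0.
Qed.

(** Counting inversions as a double product makes the sign multiplicative in each argument under
    disjoint unions, which is what associativity needs. *)
Lemma esgnE n (S T : {set edge n}) :
  esgn S T = \prod_(p in S) \prod_(q in T)
    (if (enum_rank q < enum_rank p)%N then -1 else 1).
Proof.
rewrite /esgn -prodr_const pair_big /= big_mkcond [RHS]big_mkcond.
apply: eq_bigr => -[p q] _; rewrite inE /=.
by case: (p \in S); case: (q \in T) => //=; case: ifP.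
Qed.

Lemma esgnUl n (S T U : {set edge n}) :
  [disjoint S & T] -> esgn (S :|: T) U = esgn S U * esgn T U.
Proof.
by move=> dST; rewrite !esgnE -bigU //; apply: eq_bigl => p; rewrite inE.
Qed.

Lemma esgnUr n (S T U : {set edge n}) :
  [disjoint T & U] -> esgn S (T :|: U) = esgn S T * esgn S U.
Proof.
move=> dTU; rewrite !esgnE -big_split; apply: eq_bigr => p _ /=.
by rewrite -bigU //; apply: eq_bigl => q; rewrite inE.
Qed.

(** Both sides vanish unless the three sets are pairwise disjoint, and then both signs are the
    product of the three pairwise signs. *)
Lemma ewedgeA_basis n (S T U : {set edge n}) :
  ewedge (ewedge (ebasis S) (ebasis T)) (ebasis U) =
  ewedge (ebasis S) (ewedge (ebasis T) (ebasis U)).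
Proof.
rewrite !ewedge_basisE /ewedge_basis.
have dl : [disjoint S :|: T & U] = [disjoint S & U] && [disjoint T & U].
  by rewrite -!setI_eq0 setIUl setU_eq0.
have dr : [disjoint S & T :|: U] = [disjoint S & T] && [disjoint S & U].
  by rewrite -!setI_eq0 setIUr setU_eq0.
have [dST|dST] := boolP [disjoint S & T]; last first.
  by rewrite ewedge0x; case: ifP => _; rewrite ?ewedgex0 // ewedgeZr
     ewedge_basisE /ewedge_basis dr (negbTE dST) scaler0.
have [dTU|dTU] := boolP [disjoint T & U]; last first.
  by rewrite ewedgex0 ewedgeZl ewedge_basisE /ewedge_basis dl (negbTE dTU) andbF
     scaler0.
rewrite ewedgeZl ewedgeZr !ewedge_basisE /ewedge_basis dl dr dST dTU andbT /=.
case: ifP => dSU; last by rewrite !scaler0.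
rewrite (esgnUl U dST) (esgnUr S dTU) setUA.
rewrite [LHS]scalerA [RHS]scalerA.
suff -> : esgn S T * (esgn S U * esgn T U) = esgn T U * (esgn S T * esgn S U).
  by [].
by rewrite mulrA mulrC.
Qed.

Lemma ext_ind n (P : ext n -> Prop) :
  P 0 -> (forall x y, P x -> P y -> P (x + y)) ->
  (forall a x, P x -> P (a *: x)) -> (forall S, P (ebasis S)) -> forall x, P x.
Proof.
move=> P0 PD PZ Pe x; rewrite (ext_ebasis x).
by apply: big_ind => // S _; exact: PZ.
Qed.

Lemma ewedgeA n (x y z : ext n) : ewedge (ewedge x y) z = ewedge x (ewedge y z).
Proof.
move: x; apply: ext_ind => [|x x' Ex Ex'|a x Ex|S].
- by rewrite !ewedge0x.
- by rewrite !ewedgeDl Ex Ex'.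
- by rewrite !ewedgeZl Ex.
move: y; apply: ext_ind => [|y y' Ey Ey'|a y Ey|T].
- by rewrite ewedge0x !ewedgex0 ewedge0x.
- by rewrite ewedgeDl !ewedgeDr ewedgeDl Ey Ey'.
- by rewrite ewedgeZl !ewedgeZr ewedgeZl Ey.
move: z; apply: ext_ind => [|z z' Ez Ez'|a z Ez|U].
- by rewrite !ewedgex0.
- by rewrite !ewedgeDr Ez Ez'.
- by rewrite !ewedgeZr Ez.
exact: ewedgeA_basis.
Qed.

Lemma ewedge1x n (x : ext n) : ewedge (ebasis set0) x = x.
Proof.
move: x; apply: ext_ind => [|x y Ex Ey|a x Ex|S].
- exact: ewedgex0.
- by rewrite ewedgeDr Ex Ey.
- by rewrite ewedgeZr Ex.
rewrite ewedge_basisE /ewedge_basis -setI_eq0 set0I eqxx set0U esgnE.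
by rewrite big_pred0 ?scale1r // => p; rewrite inE.
Qed.

Lemma ewedgex1 n (x : ext n) : ewedge x (ebasis set0) = x.
Proof.
move: x; apply: ext_ind => [|x y Ex Ey|a x Ex|S].
- exact: ewedge0x.
- by rewrite ewedgeDl Ex Ey.
- by rewrite ewedgeZl Ex.
rewrite ewedge_basisE /ewedge_basis -setI_eq0 setI0 eqxx setU0 esgnE.
by rewrite big1 ?scale1r // => p _; rewrite big_pred0 // => q; rewrite inE.
Qed.

(** * Generators and elements of degree one *)

Lemma rgen_diag n (i : 'I_n) : rgen i i = 0.
Proof. by rewrite /rgen insubF //= eqxx. Qed.

Lemma rgen_val n (g : edge n) : rgen (val g).1 (val g).2 = ebasis [set g].
Proof. by rewrite /rgen -surjective_pairing valK. Qed.

Lemma rgenE n (i j : 'I_n) (nij : i != j) :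
  rgen i j = ebasis [set Sub (i, j) nij : edge n].
Proof. by rewrite -rgen_val. Qed.

Definition deg1 n (x : ext n) : Prop :=
  exists a : edge n -> rat, x = \sum_g a g *: ebasis [set g].

Lemma deg1_0 n : deg1 (0 : ext n).
Proof. by exists (fun=> 0); rewrite big1 // => g _; rewrite scale0r. Qed.

Lemma deg1_rgen n (i j : 'I_n) : deg1 (rgen i j).
Proof.
have [->|nij] := eqVneq i j; first by rewrite rgen_diag; exact: deg1_0.
rewrite rgenE; set g := Sub _ _; exists (fun h => (h == g)%:R).
rewrite (bigD1 g) //= eqxx scale1r big1 ?addr0 // => h /negbTE->.
by rewrite scale0r.
Qed.

Lemma deg1B n (x y : ext n) : deg1 x -> deg1 y -> deg1 (x - y).
Proof.
move=> [a ->] [b ->]; exists (fun g => a g - b g).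
by rewrite -sumrB; apply: eq_bigr => g _; rewrite scalerBl.
Qed.

Lemma deg1_sum n I (r : seq I) (P : pred I) (E : I -> ext n) :
  (forall i, P i -> deg1 (E i)) -> deg1 (\sum_(i <- r | P i) E i).
Proof.
move=> dE; apply: big_ind => //; first exact: deg1_0.
by move=> x y dx dy; rewrite -[y]opprK; apply: deg1B => //;
  rewrite -sub0r; apply: deg1B => //; exact: deg1_0.
Qed.

(** For distinct generators exactly one of the two orders is an inversion; for equal ones both sides
    are zero. *)
Lemma ewedge_gen_anti n (g h : edge n) :
  ewedge (ebasis [set g]) (ebasis [set h]) =
  - ewedge (ebasis [set h]) (ebasis [set g]).
Proof.
rewrite !ewedge_basisE /ewedge_basis !disjoints1 !inE.
have [<-|ngh] := eqVneq g h; first by rewrite /= oppr0.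
rewrite setUC -scaleNr; congr (_ *: _).
rewrite !esgnE !big_set1.
have : enum_rank g != enum_rank h by rewrite (inj_eq enum_rank_inj).
by rewrite neq_ltn; case: ltngtP => //= _ _; rewrite opprK.
Qed.

Lemma ewedge_deg1_anti n (x y : ext n) :
  deg1 x -> deg1 y -> ewedge x y = - ewedge y x.
Proof.
move=> [a ->] [b ->]; rewrite ewedge_suml ewedge_sumr -sumrN.
apply: eq_bigr => g _; rewrite ewedgeZl ewedgeZr -scalerN; congr (_ *: _).
rewrite ewedge_sumr ewedge_suml -sumrN; apply: eq_bigr => h _.
by rewrite ewedgeZl ewedgeZr -scalerN ewedge_gen_anti.
Qed.

Lemma ewedge_deg1_sqr n (x : ext n) : deg1 x -> ewedge x x = 0.
Proof.
move=> dx; have /eqP := ewedge_deg1_anti dx dx.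
by rewrite -subr_eq0 opprK -mulr2n -scaler_nat scaler_eq0 /= => /eqP.
Qed.

(** * Words and substitution morphisms *)

Definition emon n (F : 'I_n -> 'I_n -> ext n) (w : seq ('I_n * 'I_n)) : ext n :=
  foldr (fun p x => ewedge (F p.1 p.2) x) (ebasis set0) w.

Definition eword n (S : {set edge n}) : seq ('I_n * 'I_n) := map val (enum S).

(** The linear extension to all monomials of the substitution of [F i j] for r_ij. It is an algebra
    endomorphism once the values have degree 1 and vanish on the diagonal. *)
Definition esubst n (F : 'I_n -> 'I_n -> ext n) (x : ext n) : ext n :=
  \sum_(S : {set edge n}) x S *: emon F (eword S).

Lemma index_enum_rank (T : finType) (x : T) : index x (enum T) = enum_rank x.
Proof.
rewrite -[in LHS](nth_enum_rank x x) index_uniq ?enum_uniq //.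
by rewrite -cardE ltn_ord.
Qed.

(** Locates [x] in the ordered enumeration: the length of [u] is the number of factors that a
    generator must cross to reach its place in a monomial. *)
Lemma enum_setU1 (T : finType) (x : T) (S : {set T}) : x \notin S ->
  exists u v, [/\ enum S = u ++ v, enum (x |: S) = u ++ x :: v,
    {in u, forall y, (enum_rank y < enum_rank x)%N} &
    {in v, forall y, (enum_rank x < enum_rank y)%N}].
Proof.
move=> xS; have : x \in enum T by rewrite mem_enum.
case/path.splitPr def_e : {1}(enum T) / => [l1 l2].
have /= un : uniq (l1 ++ x :: l2) by rewrite -def_e enum_uniq.
move: (un); rewrite cat_uniq /= => /and3P[_ /norP[xl1 l12] /andP[xl2 _]].
have fE (A : {set T}) : enum A = filter (mem A) (enum T).
  by rewrite enumT; apply: eq_filter.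
exists (filter (mem S) l1), (filter (mem S) l2); split.
- by rewrite fE def_e filter_cat /= (negbTE xS).
- rewrite fE def_e filter_cat /= setU11; congr (_ ++ _ :: _);
    apply: eq_in_filter => y yl; rewrite /= inE in_set1; case: eqP => // yx.
  + by rewrite -yx yl in xl1.
  + by rewrite -yx yl in xl2.
- move=> y; rewrite mem_filter => /andP[_ yl1].
  rewrite -!index_enum_rank def_e !index_cat yl1 (negbTE xl1) /= eqxx addn0.
  by rewrite index_mem.
- move=> y; rewrite mem_filter => /andP[_ yl2].
  rewrite -!index_enum_rank def_e !index_cat (negbTE xl1) /= eqxx addn0.
  case: ifP => [yl1|_]; first by case/hasP: l12; exists y.
  have /negbTE-> : x != y by apply: contraNneq xl2 => ->.
  by rewrite addnS ltnS leq_addr.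
Qed.

Lemma esgn_set1 n (g : edge n) (S : {set edge n}) (u v : seq (edge n)) :
  enum S = u ++ v -> {in u, forall y, (enum_rank y < enum_rank g)%N} ->
  {in v, forall y, (enum_rank g < enum_rank y)%N} ->
  esgn [set g] S = (-1) ^+ size u.
Proof.
move=> def_S lt_u lt_v; rewrite esgnE big_set1 -big_enum /= def_S big_cat /=.
rewrite [X in _ * X]big1_seq ?mulr1 => [|q /andP[_ /lt_v]]; last first.
  by move/ltnW; rewrite leqNgt => /negbTE->.
elim: u lt_u {def_S} => [|q u IHu] lt_u; first by rewrite big_nil.
rewrite big_cons lt_u ?mem_head // IHu ?exprS // => y yu.
by apply: lt_u; rewrite inE yu orbT.
Qed.

Section Substitution.
Variables (n : nat) (F : 'I_n -> 'I_n -> ext n).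
Hypothesis F1 : forall i j, deg1 (F i j).

Lemma emon_rot p u v :
  emon F (p :: u ++ v) = (-1) ^+ size u *: emon F (u ++ p :: v).
Proof.
elim: u => [|q u IHu] /=; first by rewrite expr0 scale1r.
rewrite -ewedgeA (ewedge_deg1_anti (F1 _ _) (F1 _ _)) ewedgeNl ewedgeA.
by move: IHu => /= ->; rewrite ewedgeZr exprS mulN1r scaleNr.
Qed.

(** The scalar is a sign, left unspecified because membership in a subspace does not depend on
    it. *)
Lemma emon_perm u v : perm_eq u v -> exists a : rat, emon F u = a *: emon F v.
Proof.
elim: u v => [|p u IHu] v.
  by rewrite perm_sym => /perm_nilP->; exists 1; rewrite scale1r.
move=> puv; have pv : p \in v by rewrite -(perm_mem puv) mem_head.
case/path.splitPr: pv puv => v1 v2 puv.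
have {IHu}[|a Ea] := IHu (v1 ++ v2).
  by rewrite -(perm_cons p) (perm_trans puv) // -cat1s perm_catCA.
exists (a * (-1) ^+ size v1); rewrite -scalerA -emon_rot /= Ea.
by rewrite ewedgeZr.
Qed.

(** The occurrence of [p] in [w] can be brought to the front, where a square of degree 1 appears. *)
Lemma emon_dup p w : p \in w -> ewedge (F p.1 p.2) (emon F w) = 0.
Proof.
case/path.splitPr => u v; have /= := emon_rot p u v.
move/(congr1 (ewedge (F p.1 p.2))); rewrite -ewedgeA ewedge_deg1_sqr //.
rewrite ewedge0x ewedgeZr => /esym/eqP.
by rewrite scaler_eq0 signr_eq0 => /eqP.
Qed.

Lemma emon_eq0 p w : F p.1 p.2 = 0 -> p \in w -> emon F w = 0.
Proof.
move=> Fp0; elim: w => //= q w IHw; rewrite inE => /predU1P[<-|/IHw->].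
  by rewrite Fp0 ewedge0x.
by rewrite ewedgex0.
Qed.

Lemma esubst_ebasis S : esubst F (ebasis S) = emon F (eword S).
Proof.
rewrite /esubst (bigD1 S) //= ffunE eqxx scale1r big1 ?addr0 // => T TS.
by rewrite ffunE (negbTE TS) scale0r.
Qed.

Lemma esubst0 : esubst F 0 = 0.
Proof. by rewrite /esubst big1 // => S _; rewrite ffunE scale0r. Qed.

Lemma esubstD x y : esubst F (x + y) = esubst F x + esubst F y.
Proof.
by rewrite -big_split; apply: eq_bigr => S _; rewrite ffunE scalerDl.
Qed.

Lemma esubstZ a x : esubst F (a *: x) = a *: esubst F x.
Proof.
by rewrite scaler_sumr; apply: eq_bigr => S _; rewrite ffunE scalerA.
Qed.

Lemma esubstB x y : esubst F (x - y) = esubst F x - esubst F y.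
Proof. by rewrite -scaleN1r esubstD esubstZ scaleN1r. Qed.

Lemma esubst_sum I (r : seq I) (P : pred I) (E : I -> ext n) :
  esubst F (\sum_(i <- r | P i) E i) = \sum_(i <- r | P i) esubst F (E i).
Proof. by elim/big_rec2: _ => [|i x y _ <-]; rewrite ?esubstD ?esubst0. Qed.

Hypothesis F0 : forall i, F i i = 0.

(** The sign [esgn] of inserting a generator into a monomial equals the sign of moving the factor
    [F i j] to the same place. If the generator already occurs, both sides are zero. *)
Lemma esubst_rgenl i j x :
  esubst F (ewedge (rgen i j) x) = ewedge (F i j) (esubst F x).
Proof.
have [->|nij] := eqVneq i j.
  by rewrite rgen_diag F0 !ewedge0x esubst0.
rewrite rgenE; set g := Sub _ _; have gE : val g = (i, j) by [].
move: x; apply: ext_ind => [|x y Ex Ey|a x Ex|S].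
- by rewrite esubst0 !ewedgex0 esubst0.
- by rewrite esubstD !ewedgeDr esubstD Ex Ey.
- by rewrite esubstZ !ewedgeZr esubstZ Ex.
rewrite ewedge_basisE /ewedge_basis disjoints1 esubst_ebasis.
case: ifP => [gS|/negbFE gS]; last first.
  rewrite esubst0 (@emon_dup (i, j)) // -gE map_f //.
  by rewrite mem_enum.
have [u [v [Eu Ev lu lv]]] := enum_setU1 gS.
rewrite esubstZ esubst_ebasis (esgn_set1 Eu lu lv) /eword Eu Ev !map_cat.
by rewrite map_cons gE -[size u](size_map val) -emon_rot.
Qed.

End Substitution.

Section SubstMorphism.
Variables (n : nat) (F : 'I_n -> 'I_n -> ext n).
Hypothesis F1 : forall i j, deg1 (F i j).
Hypothesis F0 : forall i, F i i = 0.

Lemma esubst_emon w : esubst F (emon (@rgen n) w) = emon F w.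
Proof.
elim: w => [|p w IHw] /=; last by rewrite esubst_rgenl // IHw.
by rewrite esubst_ebasis /eword enum_set0.
Qed.
End SubstMorphism.

(** The scalar is 0 when the word has a repeated or diagonal letter, and a sign otherwise. *)
Lemma emon_rgen n (w : seq ('I_n * 'I_n)) :
  exists a, emon (@rgen n) w = a *: ebasis [set g : edge n | val g \in w].
Proof.
elim: w => [|[i j] w [a Ea]] /=.
  exists 1; rewrite scale1r; congr ebasis.
have [<-|nij] := eqVneq i j.
  by exists 0; rewrite rgen_diag ewedge0x scale0r.
rewrite rgenE Ea ewedgeZr ewedge_basisE /ewedge_basis.
case: ifP => _; last by exists 0; rewrite scaler0 scale0r.
set g := Sub _ _; set s := esgn _ _; exists (a * s); rewrite scalerA.
congr (_ *: ebasis _); apply/setP => h; rewrite !inE; congr (_ || _).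
Qed.

Lemma ebasis_emon n (S : {set edge n}) :
  exists a, ebasis S = a *: emon (@rgen n) (eword S).
Proof.
(* An arbitrary duplicate-free list, in any order, lets the induction peel off the first generator;
   the sign produced is invertible. *)
suff key (s : seq (edge n)) : uniq s ->
    exists a, ebasis [set g in s] = a *: emon (@rgen n) (map val s).
  by have := key (enum S) (enum_uniq S); rewrite set_enum.
elim: s => [_|g s IHs /andP[gs /IHs[a Ea]]].
  by exists 1; rewrite scale1r set_nil.
set t := esgn [set g] [set h in s].
have t0 : t != 0 by rewrite /t /esgn expf_neq0.
have : ewedge (ebasis [set g]) (ebasis [set h in s]) = t *: ebasis [set h in g :: s].
  by rewrite ewedge_basisE /ewedge_basis disjoints1 inE gs set_cons.
rewrite Ea ewedgeZr -rgen_val => E; exists (t^-1 * a).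
by rewrite -scalerA /= E scalerA mulVf // scale1r.
Qed.

Lemma esubst_ewedge n (F : 'I_n -> 'I_n -> ext n) x y :
  (forall i j, deg1 (F i j)) -> (forall i, F i i = 0) ->
  esubst F (ewedge x y) = ewedge (esubst F x) (esubst F y).
Proof.
move=> F1 F0; move: x; apply: ext_ind => [|x x' Ex Ex'|a x Ex|S].
- by rewrite ewedge0x !esubst0 ewedge0x.
- by rewrite ewedgeDl !esubstD ewedgeDl Ex Ex'.
- by rewrite ewedgeZl !esubstZ ewedgeZl Ex.
have [a ->] := ebasis_emon S; rewrite ewedgeZl !esubstZ ewedgeZl; congr (_ *: _).
rewrite esubst_emon //; elim: (eword S) => [|p w IHw] /=.
  by rewrite !ewedge1x.
by rewrite ewedgeA esubst_rgenl // IHw ewedgeA.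
Qed.

(** * Reduction of words to chain gangs *)

Definition chain_word (T : Type) (c : seq T) : seq (T * T) := zip c (behead c).

Ltac perm_by_count :=
  apply/permP => ?; rewrite -?cats1; do 3!rewrite /= ?count_cat; clear; lia.

(* Membership of monomials in a subspace containing the ideal, with signs dropped:
   a relation between three monomials says that two of them in the subspace
   force the third. *)
Record word_closed (T : eqType) (G : seq (T * T) -> Prop) : Prop := WordClosed {
  wc_perm : forall u v, perm_eq u v -> G u -> G v;
  wc_diag : forall i w, G ((i, i) :: w);
  wc_dup : forall p w, G (p :: p :: w);
  wc_rev : forall i j w, G ((i, j) :: (j, i) :: w);
  wc_out : forall i j k w, uniq [:: i; j; k] ->
    G ((i, j) :: (j, k) :: w) -> G ((i, k) :: (k, j) :: w) ->
    G ((i, j) :: (i, k) :: w);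
  wc_path : forall i j k w, uniq [:: i; j; k] ->
    G ((i, j) :: (i, k) :: w) -> G ((i, k) :: (k, j) :: w) ->
    G ((i, j) :: (j, k) :: w);
  wc_in : forall i j k w, uniq [:: i; j; k] ->
    G ((i, j) :: (j, k) :: w) -> G ((j, i) :: (i, k) :: w) ->
    G ((i, k) :: (j, k) :: w)
}.

(** Allows a letter to be set aside while a relation is applied to the rest of the word. *)
Lemma word_closed_cons (T : eqType) (G : seq (T * T) -> Prop) p :
  word_closed G -> word_closed (fun w => G (p :: w)).
Proof.
move=> GC; have Gp := wc_perm GC.
have sw q r w : perm_eq (q :: r :: p :: w) (p :: q :: r :: w).
  by perm_by_count.
have sw' q r w : perm_eq (p :: q :: r :: w) (q :: r :: p :: w).
  by perm_by_count.
split.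
- by move=> u v puv; apply: Gp; rewrite perm_cons.
- move=> i w; apply: Gp (wc_diag GC i (p :: w)).
  by perm_by_count.
- by move=> q w; apply: Gp (wc_dup GC q (p :: w)).
- by move=> i j w; apply: Gp (wc_rev GC i j (p :: w)).
- move=> i j k w u3 /(Gp _ _ (sw' _ _ _)) g1 /(Gp _ _ (sw' _ _ _)) g2.
  exact: Gp (sw _ _ _) (wc_out GC u3 g1 g2).
- move=> i j k w u3 /(Gp _ _ (sw' _ _ _)) g1 /(Gp _ _ (sw' _ _ _)) g2.
  exact: Gp (sw _ _ _) (wc_path GC u3 g1 g2).
- move=> i j k w u3 /(Gp _ _ (sw' _ _ _)) g1 /(Gp _ _ (sw' _ _ _)) g2.
  exact: Gp (sw _ _ _) (wc_in GC u3 g1 g2).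
Qed.

Lemma word_closed_cat (T : eqType) (G : seq (T * T) -> Prop) u :
  word_closed G -> word_closed (fun w => G (u ++ w)).
Proof.
by elim: u G => //= p u IHu G /(word_closed_cons p)/IHu.
Qed.

Lemma chain_word_cat (T : Type) (a b : seq T) i :
  chain_word (a ++ i :: b) = chain_word (rcons a i) ++ chain_word (i :: b).
Proof. by elim: a => //= j [|k a] //= IHa; rewrite /chain_word /= -IHa. Qed.

Lemma chain_word_cat3 (T : Type) (a b c : seq T) i j :
  chain_word (a ++ i :: b ++ j :: c) =
  chain_word (rcons a i) ++ chain_word (i :: rcons b j) ++ chain_word (j :: c).
Proof. by rewrite chain_word_cat (chain_word_cat (i :: b)). Qed.

Lemma chain_word_rcons2 (T : Type) (a : seq T) i j :
  chain_word (rcons (rcons a i) j) = rcons (chain_word (rcons a i)) (i, j).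
Proof. by rewrite -[in LHS]cats1 cat_rcons chain_word_cat /= cats1. Qed.

Section Words.
Variable T : eqType.
Implicit Types (G : seq (T * T) -> Prop) (i j k : T) (a b c : seq T).

(* r_ij r_ik = r_ij r_jk - r_ik r_kj, with k the head of a, moves the branch point
   one step along one of the two branches. *)
Lemma word_closed_branch G i a j b : word_closed G ->
    uniq (i :: a ++ j :: b) ->
    (forall w, perm_eq w (a ++ j :: b) -> G (chain_word (i :: w))) ->
  G ((i, j) :: chain_word (i :: a) ++ chain_word (j :: b)).
Proof.
have [m] := ubnP (size a + size b); elim: m G i a j b => // m IHm G i a j b.
rewrite ltnS => lem GC Un GW; case: a => [|k a] in lem Un GW *.
  exact: (GW (j :: b)).
have u3 : uniq [:: i; j; k].
  move: Un; rewrite /= !inE !mem_cat !inE !negb_or.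
  by case/and3P=> /and3P[-> _ /andP[-> _]] /and3P[_ kj _] _; rewrite eq_sym kj.
apply: (wc_out GC u3 (w := chain_word (k :: a) ++ chain_word (j :: b))).
(* With the edge (i, j) set aside, the tree now branches at j, into [b] and [k :: a]; the total
   length has dropped by one. *)
- apply: (wc_perm GC (u := (i, j) :: (j, k) ::
            chain_word (j :: b) ++ chain_word (k :: a))).
    by rewrite !perm_cons perm_catC.
  apply: (IHm (fun w => G ((i, j) :: w)) j b k a).
  + by rewrite addnC.
  + exact: word_closed_cons.
  + case/andP: Un => _ Un; rewrite (perm_uniq (s2 := (k :: a) ++ j :: b)) //.
    by perm_by_count.
  + move=> w pw; apply: (GW (j :: w)).
    by apply: perm_trans (_ : perm_eq (j :: b ++ k :: a) _); rewrite ?perm_cons //;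
      perm_by_count.
(* With the edge (i, k) set aside, the tree branches at k, into [a] and [j :: b]. *)
- apply: (IHm (fun w => G ((i, k) :: w)) k a j b) => //.
  + exact: word_closed_cons.
  + by case/andP: Un.
  + move=> w pw; apply: (GW (k :: w)).
    by rewrite /= perm_cons.
Qed.

(** The mirror image of branching: two paths meet at j. With k the predecessor of j, r_ij r_kj =
    r_ik r_kj - r_ki r_ij moves the meeting point back to k or to i, and every resulting path ends
    at j. *)
Lemma word_closed_merge G i a j b : word_closed G ->
    uniq (rcons a i ++ rcons b j) ->
    (forall w, perm_eq w (rcons a i ++ b) -> G (chain_word (rcons w j))) ->
  G ((i, j) :: chain_word (rcons a i) ++ chain_word (rcons b j)).
Proof.
have [m] := ubnP (size a + size b); elim: m G i a j b => // m IHm G i a j b.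
rewrite ltnS => lem GC Un GW; case/lastP: b => [|b k] in lem Un GW *.
  apply: (wc_perm GC) (GW (rcons a i) _); last by rewrite cats0.
  by rewrite chain_word_rcons2 cats0 perm_rcons.
rewrite size_rcons addnS in lem.
have u3 : uniq [:: i; k; j].
  have : uniq ((a ++ b) ++ [:: i; k; j]).
    rewrite (perm_uniq (s2 := rcons a i ++ rcons (rcons b k) j)) //.
    by perm_by_count.
  by rewrite cat_uniq => /and3P[].
apply: (wc_perm GC (u := (i, j) :: (k, j) ::
          chain_word (rcons a i) ++ chain_word (rcons b k))).
  by rewrite chain_word_rcons2; perm_by_count.
apply: (wc_in GC u3).
- apply: (wc_perm GC (u := (k, j) :: (i, k) ::
          chain_word (rcons a i) ++ chain_word (rcons b k))).
    by perm_by_count.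
  apply: (IHm (fun w => G ((k, j) :: w)) i a k b) => //; first exact: word_closed_cons.
  + by move: Un; rewrite -[rcons (rcons b k) j]cats1 catA cat_uniq => /and3P[].
  + move=> w pw; apply: (wc_perm GC) (GW (rcons w k) _).
      by rewrite chain_word_rcons2 perm_rcons.
    by rewrite -rcons_cat perm_rcons perm_sym perm_rcons perm_cons perm_sym.
- apply: (wc_perm GC (u := (i, j) :: (k, i) ::
          chain_word (rcons b k) ++ chain_word (rcons a i))).
    by perm_by_count.
  apply: (IHm (fun w => G ((i, j) :: w)) k b i a).
  + by rewrite addnC.
  + exact: word_closed_cons.
  + have : uniq (rcons a i ++ rcons b k).
      by move: Un; rewrite -[rcons (rcons b k) j]cats1 catA cat_uniq => /and3P[].
    by rewrite uniq_catC.
  + move=> w pw; apply: (wc_perm GC) (GW (rcons w i) _).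
      by rewrite chain_word_rcons2 perm_rcons.
    by move/permP in pw; apply/permP => P; rewrite -!cats1 !count_cat pw -cats1
      count_cat /=; rewrite count_cat /=; lia.
Qed.

(** A new edge between two chains gives a tree: the parts ending at i and j are first merged into
    one path, then the part of the first chain after i is shuffled in as a branch. *)
Lemma word_closed_join G i j a a' b b' : word_closed G ->
    uniq ((a ++ i :: a') ++ b ++ j :: b') ->
    (forall w, perm_eq w ((a ++ i :: a') ++ b ++ j :: b') -> G (chain_word w)) ->
  G ((i, j) :: chain_word (a ++ i :: a') ++ chain_word (b ++ j :: b')).
Proof.
move=> GC Un GW; set r := chain_word (i :: a') ++ chain_word (j :: b').
(* The tails leaving i and j, collected in [r], wait while the two initial parts are merged. *)
apply: (wc_perm GC (u := r ++ (i, j) :: chain_word (rcons a i) ++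
                                        chain_word (rcons b j))).
  by rewrite !chain_word_cat /r; perm_by_count.
apply: (word_closed_merge (G := fun w => G (r ++ w))) => [||w pw].
- exact: word_closed_cat.
- apply: (subseq_uniq _ Un); apply: cat_subseq;
    by rewrite -cat_rcons prefix_subseq // prefix_prefix.
have iw : i \in w by rewrite (perm_mem pw) mem_cat mem_rcons mem_head.
have Un' : uniq (w ++ j :: a' ++ b').
  rewrite (perm_uniq (s2 := (a ++ i :: a') ++ b ++ j :: b')) //.
  move/permP in pw; apply/permP => P.
  by rewrite !count_cat pw -cats1 /= !count_cat /=; lia.
have {pw} GW' x : perm_eq x (w ++ j :: a' ++ b') -> G (chain_word x).
  move=> px; apply: GW; apply: perm_trans px _.
  move/permP in pw; apply/permP => P.
  by rewrite !count_cat pw -cats1 !count_cat /= !count_cat /=; lia.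
(* The merged path runs through [w1], i, [w2], j and on into [b'], and [a'] still hangs from i, so i
   is the only branch point left. *)
case/path.splitPr: iw GW' Un' => w1 w2 GW' Un'.
apply: (wc_perm GC (u := chain_word (rcons w1 i) ++ chain_word (i :: a') ++
                         chain_word (i :: w2 ++ j :: b'))).
  have -> : chain_word (i :: w2 ++ j :: b') =
      chain_word (i :: rcons w2 j) ++ chain_word (j :: b').
    exact: (chain_word_cat (i :: w2)).
  by rewrite rcons_cat rcons_cons chain_word_cat /r; perm_by_count.
case: a' => [|k a'] in GW' Un' {GW Un r}*.
  rewrite /= -chain_word_cat; apply: GW'.
  by rewrite -catA.
apply: (wc_perm GC (u := chain_word (rcons w1 i) ++ (i, k) ::
          chain_word (i :: w2 ++ j :: b') ++ chain_word (k :: a'))).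
  rewrite -[chain_word [:: i, k & a']]/((i, k) :: chain_word (k :: a')).
  by perm_by_count.
apply: (word_closed_branch (G := fun w => G (chain_word (rcons w1 i) ++ w))).
- exact: word_closed_cat.
- have : uniq (w1 ++ i :: (w2 ++ j :: b') ++ k :: a').
    rewrite (perm_uniq (s2 := (w1 ++ i :: w2) ++ j :: (k :: a') ++ b')) //.
    by perm_by_count.
  by rewrite cat_uniq => /and3P[].
- move=> x pw; rewrite -chain_word_cat; apply: GW'.
  move/permP in pw; apply/permP => P.
  by rewrite count_cat /= pw; do 3!rewrite ?count_cat /=; lia.
Qed.

(** In r_ij r_jk = r_ij r_ik + r_ik r_kj, both terms on the right contain the edge (i, k), which
    closes a shorter cycle, down to r_ij r_ji. *)
Lemma word_closed_cycle G i j c : word_closed G ->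
  uniq (j :: rcons c i) -> G ((i, j) :: chain_word (j :: rcons c i)).
Proof.
elim: c G j => [|k c IHc] G j GC Un; first exact: wc_rev.
have u3 : uniq [:: i; j; k].
  move: Un; rewrite /= !inE !mem_rcons !inE !negb_or => /and3P[/and3P[jk ji _]].
  by rewrite eq_sym => /andP[-> _] _; rewrite eq_sym ji jk.
have Un' : uniq (k :: rcons c i) by case/andP: Un.
apply: (wc_path GC u3 (w := chain_word (k :: rcons c i))).
  exact: (IHc _ _ (word_closed_cons _ GC) Un').
apply: (wc_perm GC (u := (k, j) :: (i, k) :: chain_word (k :: rcons c i))).
  by perm_by_count.
exact: (IHc _ _ (word_closed_cons _ GC) Un').
Qed.

(** In r_ij r_ik = r_ij r_jk - r_ik r_kj, the first term closes a cycle through (j, k) and the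
    second has the shorter chord (k, j), down to a repeated edge. *)
Lemma word_closed_chord G i j c : word_closed G ->
  uniq (i :: rcons c j) -> G ((i, j) :: chain_word (i :: rcons c j)).
Proof.
elim: c G i => [|k c IHc] G i GC Un; first exact: wc_dup.
have u3 : uniq [:: i; j; k].
  move: Un; rewrite /= !inE !mem_rcons !inE !negb_or => /and3P[/and3P[ik ij _]].
  by rewrite eq_sym => /andP[jk _] _; rewrite ik ij jk.
have Un' : uniq (k :: rcons c j) by case/andP: Un.
apply: (wc_out GC u3 (w := chain_word (k :: rcons c j))).
  apply: (word_closed_cycle (word_closed_cons _ GC)).
  by [].
exact: (IHc _ _ (word_closed_cons _ GC) Un').
Qed.

End Words.

Lemma gang_word_total n (G : seq ('I_n * 'I_n) -> Prop) : word_closed G ->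
    (forall cs, is_chain_gang cs -> G (flatten (map (@chain_word _) cs))) ->
  forall w, G w.
Proof.
move=> GC Ggang w; elim: w G GC Ggang => [|[i j] w IHw] G GC Ggang.
  have := Ggang [seq [:: i] | i <- enum 'I_n].
  have -> : flatten (map (@chain_word _) [seq [:: i] | i <- enum 'I_n]) = [::].
    by elim: (enum _).
  apply; rewrite /is_chain_gang; apply/andP; split.
    by apply/allP => c /mapP[i _ ->].
  by rewrite flatten_seq1.
have [<-|nij] := eqVneq i j; first exact: wc_diag.
(* Absorbing the letter into the predicate leaves only the product of one edge with a chain gang. *)
apply: (IHw (fun w => G ((i, j) :: w))); first exact: word_closed_cons.
move=> cs /andP[cs0 pcs].
have [c1 c1cs ic1] : exists2 c, c \in cs & i \in c.
  by apply/flattenP; rewrite (perm_mem pcs) mem_enum.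
have ucs : uniq (flatten cs) by rewrite (perm_uniq pcs) enum_uniq.
have p1 := perm_to_rem c1cs.
have u1 : uniq c1.
  by move: ucs; rewrite (perm_uniq (perm_flatten p1)) /= cat_uniq => /and3P[].
pose r1 := flatten (map (@chain_word _) (rem c1 cs)).
have pw1 : perm_eq (flatten (map (@chain_word _) cs)) (chain_word c1 ++ r1).
  exact: (perm_flatten (perm_map (@chain_word _) p1)).
have [jc1|jc1] := boolP (j \in c1).
  (* Here p and q are i and j in their order along [c1]; the segment between them is isolated and
     the other edges become a prefix. *)
  have mid (a b c : seq 'I_n) p q :
      c1 = a ++ p :: b ++ q :: c -> uniq (p :: rcons b q) /\
      perm_eq ((chain_word (rcons a p) ++ chain_word (q :: c) ++ r1) ++
               (i, j) :: chain_word (p :: rcons b q))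
              ((i, j) :: flatten (map (@chain_word _) cs)).
    move=> Ec1; split.
      have : uniq ((a ++ c) ++ p :: rcons b q).
        by rewrite (perm_uniq (s2 := c1)) // Ec1; perm_by_count.
      by rewrite cat_uniq => /and3P[].
    apply: (perm_trans (y := (i, j) :: chain_word c1 ++ r1)).
      by rewrite Ec1 chain_word_cat3; perm_by_count.
    by rewrite perm_cons perm_sym.
  have [a [b Ec1]] : exists a b, c1 = a ++ i :: b.
    by case/path.splitPr: (ic1) => a b; exists a, b.
  (* If j precedes i, the new edge closes a cycle; if j follows i, it is a chord. *)
  move: jc1; rewrite Ec1 mem_cat inE eq_sym (negbTE nij) => /orP[] jc1.
    have [a1 [a2 Ea]] : exists a1 a2, a = a1 ++ j :: a2.
      by case/path.splitPr: jc1 => a1 a2; exists a1, a2.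
    have [|un pw] := mid a1 a2 b j i; first by rewrite Ec1 Ea -catA.
    apply: (wc_perm GC) pw _.
    exact: (word_closed_cycle (word_closed_cat _ GC)).
  have [b1 [b2 Eb]] : exists b1 b2, b = b1 ++ j :: b2.
    by case/path.splitPr: jc1 => b1 b2; exists b1, b2.
  have [|un pw] := mid a b1 b2 i j; first by rewrite Ec1 Eb.
  apply: (wc_perm GC) pw _.
  exact: (word_closed_chord (word_closed_cat _ GC)).
have jr : j \in flatten (rem c1 cs).
  have : j \in flatten cs by rewrite (perm_mem pcs) mem_enum.
  by rewrite (perm_mem (perm_flatten p1)) /= mem_cat (negbTE jc1).
have /flattenP[c2 c2r jc2] := jr; have p2 := perm_to_rem c2r.
set cs' := rem c2 (rem c1 cs) in p2.
have p12 : perm_eq cs [:: c1, c2 & cs'].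
  by apply: perm_trans p1 _; rewrite perm_cons.
have pf := perm_flatten p12; rewrite /= catA in pf.
have u12 : uniq (c1 ++ c2).
  by move: ucs; rewrite (perm_uniq pf) [uniq (_ ++ flatten _)]cat_uniq => /and3P[].
(* Any ordering of the union of the two chains, together with the remaining chains, is again a chain
   gang. *)
have GW w' : perm_eq w' (c1 ++ c2) ->
    G (flatten (map (@chain_word _) cs') ++ chain_word w').
  move=> pw'; apply: (wc_perm GC) (Ggang (w' :: cs') _).
    by rewrite /= perm_catC.
  apply/andP; split => /=.
    rewrite -size_eq0 (perm_size pw') size_cat; apply/andP; split.
      by case: (c1) ic1.
    by apply/allP => c ccs; apply: (allP cs0); rewrite (perm_mem p12) !inE ccs !orbT.
  apply: perm_trans pcs; rewrite perm_sym (perm_trans pf) //.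
  by rewrite perm_cat2r perm_sym.
apply: (wc_perm GC (u := flatten (map (@chain_word _) cs') ++
                         (i, j) :: chain_word c1 ++ chain_word c2)).
  apply: (perm_trans (y := (i, j) :: flatten (map (@chain_word _) [:: c1, c2 & cs']))).
    by perm_by_count.
  by rewrite perm_cons perm_flatten // perm_map // perm_sym.
case/path.splitPr: ic1 u12 GW => a a' u12 GW.
case/path.splitPr: jc2 u12 GW => b b' u12 GW.
exact: (word_closed_join (word_closed_cat _ GC) u12 GW).
Qed.

(** * The ideal and the span of chain gangs modulo it *)

Lemma in_pidealD n (x y : ext n) : in_pideal x -> in_pideal y -> in_pideal (x + y).
Proof.
move=> [c ->] [d ->]; exists [ffun k => c k + d k]; rewrite -big_split.
by apply: eq_bigr => k _ /=; rewrite ffunE scalerDl.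
Qed.

Lemma in_pidealZ n a (x : ext n) : in_pideal x -> in_pideal (a *: x).
Proof.
move=> [c ->]; exists [ffun k => a * c k]; rewrite scaler_sumr.
by apply: eq_bigr => k _ /=; rewrite ffunE scalerA.
Qed.

Lemma in_pideal0 n : in_pideal (0 : ext n).
Proof. by exists [ffun=> 0]; rewrite big1 // => k _; rewrite ffunE scale0r. Qed.

Lemma in_pideal_prel n (ijk : 'I_n * 'I_n * 'I_n) t w :
  in_pideal (ewedge (prel ijk t) (emon (@rgen n) w)).
Proof.
have [a ->] := emon_rgen w; rewrite ewedgeZr; apply: in_pidealZ.
set B := [set g | _]; pose k0 := ((ijk, t), (set0 : {set edge n}), B).
exists [ffun k => (k == k0)%:R].
rewrite (bigD1 k0) //= big1 ?addr0 => [|k /negbTE nk]; last first.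
  by rewrite ffunE nk scale0r.
by rewrite ffunE eqxx scale1r ewedge1x.
Qed.

Definition gang_span n (x : ext n) : Prop :=
  exists c : {ffun {set edge n} -> rat^o},
    (forall S, ~ chain_gang_graph S -> c S = 0) /\
    in_pideal (x - \sum_(S : {set edge n}) c S *: ebasis S).

Lemma gang_span_ideal n (x : ext n) : in_pideal x -> gang_span x.
Proof.
move=> xI; exists 0; split=> [S _|]; first by rewrite ffunE.
by rewrite big1 ?subr0 // => S _; rewrite ffunE scale0r.
Qed.

Lemma gang_spanD n (x y : ext n) : gang_span x -> gang_span y -> gang_span (x + y).
Proof.
move=> [c [c0 cI]] [d [d0 dI]]; exists (c + d); split=> [S gS|].
  by rewrite ffunE c0 // d0 // addr0.
have := in_pidealD cI dI; rewrite addrACA -opprD -big_split /=.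
suff -> : \sum_(S : {set edge n}) (c S *: ebasis S + d S *: ebasis S) =
  \sum_(S : {set edge n}) (c + d) S *: ebasis S by [].
by apply: eq_bigr => S _; rewrite ffunE scalerDl.
Qed.

Lemma gang_spanZ n a (x : ext n) : gang_span x -> gang_span (a *: x).
Proof.
move=> [c [c0 cI]]; exists (a *: c); split=> [S gS|].
  by rewrite ffunE c0 // scaler0.
have := in_pidealZ a cI; rewrite scalerBr scaler_sumr.
suff -> : \sum_(S : {set edge n}) a *: (c S *: ebasis S) =
  \sum_(S : {set edge n}) (a *: c) S *: ebasis S by [].
by apply: eq_bigr => S _; rewrite ffunE scalerA.
Qed.

Lemma gang_spanB n (x y : ext n) : gang_span x -> gang_span y -> gang_span (x - y).
Proof.
by move=> gx gy; rewrite -scaleN1r; apply: gang_spanD => //; apply: gang_spanZ.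
Qed.

Lemma gang_span_gang n (S : {set edge n}) :
  chain_gang_graph S -> gang_span (ebasis S).
Proof.
move=> gS; exists (ebasis S); split=> [T gT|].
  by rewrite ffunE; case: eqP => // TS; rewrite TS in gT.
by rewrite -ext_ebasis subrr; exact: in_pideal0.
Qed.

(** Each three-term relator, multiplied on the right by a word, lies in the ideal; it is solved for
    the monomial wanted. *)
Lemma gang_span_word_closed n :
  word_closed (fun w => gang_span (emon (@rgen n) w)).
Proof.
have z : gang_span (0 : ext n) by apply: gang_span_ideal; exact: in_pideal0.
have pr ijk t w : gang_span (ewedge (prel ijk t) (emon (@rgen n) w)).
  by apply: gang_span_ideal; exact: in_pideal_prel.
have neq (i j k : 'I_n) : uniq [:: i; j; k] -> [&& i != j, j != k & i != k].
  by rewrite /= !inE negb_or andbT => /andP[/andP[-> ->] ->].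
split.
- move=> u v puv gu; rewrite perm_sym in puv.
  have [a ->] := emon_perm (@deg1_rgen n) puv; exact: gang_spanZ.
- by move=> i w /=; rewrite rgen_diag ewedge0x.
- by move=> p w; have /= -> := emon_dup (@deg1_rgen n) (mem_head p w).
- move=> i j w; have [->|nij] := eqVneq i j.
    by rewrite /= rgen_diag !ewedge0x.
  have := pr (i, j, i) (Ordinal (isT : (2 < 3)%N)) w.
  by rewrite /prel /= nij ewedgeA.
- move=> i j k w /neq u3 g1 g2.
  have := pr (i, j, k) (Ordinal (isT : (0 < 3)%N)) w.
  rewrite /prel /= u3 !ewedgeBl !ewedgeA => g.
  by have := gang_spanD g (gang_spanB g1 g2); rewrite /= subrK.
- move=> i j k w /neq u3 g1 g2.
  have := pr (i, j, k) (Ordinal (isT : (0 < 3)%N)) w.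
  rewrite /prel /= u3 !ewedgeBl !ewedgeA => g.
  have := gang_spanD (gang_spanB g1 g) g2.
  by rewrite /= opprB addrCA subrr addr0 subrK.
- move=> i j k w /neq u3 g1 g2.
  have := pr (i, j, k) (Ordinal (isT : (1 < 3)%N)) w.
  rewrite /prel /= u3 !ewedgeBl !ewedgeA => g.
  by have := gang_spanD g (gang_spanB g1 g2); rewrite /= subrK.
Qed.

Lemma gang_span_total n (x : ext n) : gang_span x.
Proof.
move: x; apply: ext_ind.
- by apply: gang_span_ideal; exact: in_pideal0.
- exact: gang_spanD.
- exact: gang_spanZ.
move=> S; have [a ->] := ebasis_emon S; apply: gang_spanZ.
apply: (gang_word_total (@gang_span_word_closed n)) => cs gcs.
have [b ->] := emon_rgen (flatten (map (@chain_word _) cs)).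
by apply/gang_spanZ/gang_span_gang; exists cs.
Qed.

(** * Independence *)

(** When successors are unique, two paths from the same point follow the same orbit, so one is an
    initial part of the other. *)
Lemma connect_fun_total (T : finType) (e : rel T) :
  (forall x y z, e x y -> e x z -> y = z) ->
  forall x y z, connect e x y -> connect e x z -> connect e y z || connect e z y.
Proof.
move=> fun_e x y z /connectP[p]; elim: p x => [|x' p IHp] x /=.
  by move=> _ -> ->.
case/andP=> exx' path_p def_y /connectP[[|x'' q]] /=.
  move=> _ ->; apply/orP; right; apply: connect_trans (connect1 exx') _.
  by apply/connectP; exists p.
case/andP=> exx'' path_q def_z; apply: (IHp x') => //.
by apply/connectP; exists q; rewrite ?(fun_e _ _ _ exx' exx'').
Qed.

Lemma mem_chain_word (T : eqType) (c : seq T) i j :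
  (i, j) \in chain_word c -> exists c1 c2, c = c1 ++ [:: i, j & c2].
Proof.
elim: c => // x [|y c] // IHc; rewrite [chain_word _]/= inE.
case/orP=> [/eqP[-> ->]|/IHc[c1 [c2 ->]]]; first by exists [::], c.
by exists (x :: c1), c2.
Qed.

Lemma mem_eword n (S : {set edge n}) (g : edge n) : (val g \in eword S) = (g \in S).
Proof. by rewrite mem_map ?mem_enum //; exact: val_inj. Qed.

Lemma eword_neq n (S : {set edge n}) i j : (i, j) \in eword S -> i != j.
Proof. by case/mapP=> g _ Eg; have := valP g; rewrite -Eg. Qed.

Lemma eword_inj n (S T : {set edge n}) : eword S =i eword T -> S = T.
Proof. by move=> eST; apply/setP => g; rewrite -!mem_eword. Qed.

(** [L] is a linear order in which edges join neighbours; neighbours need not be joined. It forces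
    uniqueness of successors and predecessors and excludes cycles. For a chain gang the concatenated
    chains serve. *)
Definition consecutive n (L : seq 'I_n) (S : {set edge n}) : Prop :=
  forall i j, (i, j) \in eword S -> (j \in L) /\ index j L = (index i L).+1.

Lemma chain_gang_consecutive n (S : {set edge n}) :
  chain_gang_graph S -> exists L, consecutive L S.
Proof.
case=> cs [/andP[_ pcs] <-]; exists (flatten cs) => i j /mapP[g].
rewrite mem_enum inE => + Eg; rewrite -[val g]Eg => /flattenP[_ /mapP[c cin ->]].
case/mem_chain_word=> c1 [c2 Ec].
have un : uniq (flatten cs) by rewrite (perm_uniq pcs) enum_uniq.
have [u [v EL]] : exists u v, flatten cs = u ++ [:: i, j & v].
  case/path.splitPr: cin => s1 s2.
  exists (flatten s1 ++ c1), (c2 ++ flatten s2).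
  by rewrite flatten_cat /= Ec -!catA.
rewrite EL in un *; split; first by rewrite mem_cat !inE eqxx !orbT.
move: un; rewrite cat_uniq /= !inE !negb_or => /and3P[_ /and3P[iu ju _]].
case/and3P=> /andP[ij _] _ _.
by rewrite !index_cat (negbTE iu) (negbTE ju) /= !eqxx (negbTE ij) addn0 addn1.
Qed.

Section GangMorphism.
Variables (n : nat) (S : {set edge n}) (L : seq 'I_n).
Hypothesis LS : consecutive L S.

Definition edge_rel (T : {set edge n}) : rel 'I_n := fun i j => (i, j) \in eword T.

Local Notation reach := (connect (edge_rel S)).

Lemma reach_index i j : reach i j -> i = j \/ (index i L < index j L)%N.
Proof.
case/connectP=> p; elim: p i => [|k p IHp] i /= => [_ ->|]; first by left.
case/andP=> /LS[_ Ek] /IHp{}IHp /IHp[<-|lt_kj]; right; rewrite -Ek //.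
exact: ltnW.
Qed.

Lemma reach_anti i j : reach i j -> reach j i -> i = j.
Proof.
move=> /reach_index[//|ij] /reach_index[//|ji].
by have := ltn_trans ij ji; rewrite ltnn.
Qed.

Lemma reach_out i j k : reach i j -> reach i k -> reach j k || reach k j.
Proof.
apply: connect_fun_total => x y z /LS[yL Ey] /LS[zL Ez].
by apply: (index_inj x yL zL); rewrite Ey Ez.
Qed.

(** The argument for a common source, applied to the reversed edges. *)
Lemma reach_in i j k : reach i k -> reach j k -> reach i j || reach j i.
Proof.
have rev_fun x y z : edge_rel S y x -> edge_rel S z x -> y = z.
  move=> /LS[xL Ey] /LS[_ Ez].
  have Eyz : index y L = index z L by apply: succn_inj; rewrite -Ey.
  have yL : y \in L by move: xL; rewrite -!index_mem Ey => /ltnW.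
  by apply: (index_inj x yL) => //; rewrite -index_mem -Eyz index_mem.
have := connect_fun_total (e := [rel x y | edge_rel S y x]) rev_fun.
move=> /(_ k i j) reach_k; rewrite !connect_rev /= in reach_k.
by rewrite orbC; exact: reach_k.
Qed.

(** The potential at i sums the generators between neighbours of [L] up to the position of i, so its
    difference along an edge telescopes to one generator. *)
Lemma reach_potential : exists h : 'I_n -> ext n, (forall i, deg1 (h i)) /\
  forall i j, (i, j) \in eword S -> h j - h i = rgen i j.
Proof.
case EL: L => [|i0 L0].
  by exists (fun=> 0); split=> [_|i j /LS[]]; [exact: deg1_0 | rewrite EL].
exists (fun i => \sum_(0 <= t < index i L) rgen (nth i0 L t) (nth i0 L t.+1)).
split=> [i|i j /LS[jL Ej]]; first by apply: deg1_sum => t _; exact: deg1_rgen.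
have iL : i \in L by move: jL; rewrite -!index_mem Ej => /ltnW.
by rewrite Ej big_nat_recr //= addrAC subrr add0r -Ej !nth_index.
Qed.

Lemma reach_morphism : exists F : 'I_n -> 'I_n -> ext n,
  [/\ forall i j, deg1 (F i j), forall ijk t, esubst F (prel ijk t) = 0,
      forall i, F i i = 0,
      {in eword S, forall p, F p.1 p.2 = rgen p.1 p.2} &
      forall i j, ~~ reach i j -> F i j = 0].
Proof.
have [h [h1 hE]] := reach_potential.
pose F i j := if reach i j then h j - h i else 0.
have F1 i j : deg1 (F i j).
  by rewrite /F; case: ifP => _; [apply: deg1B | exact: deg1_0].
have F0 i : F i i = 0 by rewrite /F connect0 subrr.
exists F; split=> //; last first.
- by move=> i j /negbTE nij; rewrite /F nij.
- by case=> i j p; rewrite /F /= connect1 // hE.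
have E2 i j k l : esubst F (ewedge (rgen i j) (rgen k l)) = ewedge (F i j) (F k l).
  rewrite esubst_rgenl // -[rgen k l]ewedgex1 esubst_rgenl //.
  by rewrite (esubst_emon F1 F0 [::] : esubst F (ebasis set0) = _) ewedgex1.
have sq i j : ewedge (h i - h j) (h i - h j) = 0.
  by apply: ewedge_deg1_sqr; apply: deg1B.
have anti i j k l : ewedge (h i - h j) (h k - h l) = - ewedge (h k - h l) (h i - h j).
  by apply: ewedge_deg1_anti; apply: deg1B.
case=> [[i j] k] t; rewrite /prel.
case: ifP => _.
  case: ifP => nij; last exact: esubst0.
  (* By antisymmetry i and j cannot reach each other both ways, so one factor of r_ij r_ji is sent
     to 0. *)
  rewrite E2 /F; case: ifP => ij; last by rewrite ewedge0x.
  case: ifP => ji; last by rewrite ewedgex0.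
  by rewrite (reach_anti ij ji) eqxx in nij.
case: ifP => [/and3P[nij njk nik]|_]; last exact: esubst0.
case: ifP => _; rewrite !esubstB !E2 /F.
(* If i reaches both j and k, these are comparable and one product on the right survives, equal to
   the left side. Otherwise every product vanishes, by transitivity where needed. *)
- have [ij|nrij] := boolP (reach i j); have [ik|nrik] := boolP (reach i k).
  + case/orP: (reach_out ij ik) => [jk|kj].
      rewrite jk ifN ?ewedgex0 ?subr0; last first.
        by apply: contra njk => /(reach_anti jk)->.
      by rewrite -ewedgeNr -ewedgeDr opprB [X in ewedge _ X]addrC addrA subrK sq.
    rewrite kj ifN ?ewedgex0 ?sub0r ?opprK; last first.
      by apply: contra njk => jk; rewrite (reach_anti kj jk).
    rewrite [ewedge (h j - h i) _]anti -ewedgeNr -ewedgeDr opprB addrA subrK.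
    by rewrite -[h i - h k]opprB ewedgeNr sq oppr0.
  + rewrite [reach j k](contraNF _ nrik) ?ewedgex0 ?ewedge0x ?subr0 //.
    exact: connect_trans.
  + rewrite [reach k j](contraNF _ nrij) ?ewedgex0 ?ewedge0x ?subr0 //.
    exact: connect_trans.
  + by rewrite !ewedge0x !subr0.
(* The same dichotomy, with i and j comparable because both reach k. *)
- have [ik|nrik] := boolP (reach i k); have [jk|nrjk] := boolP (reach j k).
  + case/orP: (reach_in ik jk) => [ij|ji].
      rewrite ij ifN ?ewedge0x ?subr0; last first.
        by apply: contra nij => ji; rewrite (reach_anti ij ji).
      by rewrite -ewedgeBl opprB addrA subrK sq.
    rewrite ji ifN ?ewedge0x ?sub0r ?opprK; last first.
      by apply: contra nij => ij; rewrite (reach_anti ij ji).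
    rewrite [ewedge (h k - h i) (h k - h j)]anti -ewedgeNl -ewedgeDl opprB.
    by rewrite [X in ewedge X _]addrC addrA subrK -[h i - h k]opprB ewedgeNl sq oppr0.
  + rewrite [reach j i](contraNF _ nrjk) ?ewedgex0 ?ewedge0x ?subr0 // => ji.
    exact: connect_trans ji ik.
  + rewrite [reach i j](contraNF _ nrik) ?ewedgex0 ?ewedge0x ?subr0 // => ij.
    exact: connect_trans ij jk.
  + by rewrite !ewedgex0 !subr0.
Qed.

(** Edges of [S] are covering pairs: the first vertex after i on a path of [T] to j has index above
    that of i and at most that of j, hence is j. *)
Lemma eword_sub_reach (T : {set edge n}) :
  connect (edge_rel T) =2 reach -> {subset eword S <= eword T}.
Proof.
move=> eqT [i j] ij; have nij := eword_neq ij; have [jL Ej] := LS ij.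
have : connect (edge_rel T) i j by rewrite eqT connect1.
case/connectP=> [[|k p]] /= => [_ Eji|]; first by rewrite Eji eqxx in nij.
case/andP=> ik path_p def_j.
have : reach i k by rewrite -eqT connect1.
case/reach_index=> [Eik|lt_ik]; first by have := eword_neq ik; rewrite Eik eqxx.
have : reach k j by rewrite -eqT; apply/connectP; exists p.
by case/reach_index=> [<-|lt_kj] //; move: lt_kj; rewrite Ej ltnS leqNgt lt_ik.
Qed.

End GangMorphism.

Lemma gang_free n (c : {ffun {set edge n} -> rat^o}) :
    (forall S, ~ chain_gang_graph S -> c S = 0) ->
    in_pideal (\sum_(S : {set edge n}) c S *: ebasis S) ->
  forall S : {set edge n}, c S = 0.
Proof.
move=> c0 cI S; pose R (T : {set edge n}) := [set p | connect (edge_rel T) p.1 p.2].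
(* Deciding whether [c T] is zero replaces deciding whether [T] is a chain gang. *)
have gang T : (chain_gang_graph T -> c T = 0) -> c T = 0.
  by move=> cT0; have [//|/eqP cT] := eqVneq (c T) 0; case: (cT); apply: c0 => /cT0.
have [m] := ubnP #|R S|; elim: m S => // m IHm S; rewrite ltnS => leRm.
apply: (gang S) => gS; have [L LS] := chain_gang_consecutive gS.
have [F [F1 Fprel F0 FS Fn]] := reach_morphism LS.
have F_I x : in_pideal x -> esubst F x = 0.
  case=> d ->; rewrite esubst_sum big1 // => k _; rewrite esubstZ.
  by rewrite !esubst_ewedge // Fprel ewedgex0 ewedge0x scaler0.
have FSS : esubst F (ebasis S) = ebasis S.
  have [a ->] := ebasis_emon S; rewrite esubstZ esubst_emon //; congr (_ *: _).
  elim: (eword S) FS => //= p w IHw Fpw; rewrite Fpw ?mem_head // IHw //.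
  by move=> q qw; rewrite Fpw // inE qw orbT.
(* Applying [F] leaves only [c S] times the monomial of [S], so its coefficient at [S] gives the
   claim once all other terms vanish. *)
have := F_I _ cI; rewrite esubst_sum (bigD1 S) //= big1 ?addr0 => [|T nTS].
  rewrite esubstZ FSS => /ffunP/(_ S); rewrite !ffunE eqxx.
  by rewrite [_ *: _]mulr1.
suff : c T = 0 \/ esubst F (ebasis T) = 0.
  by rewrite esubstZ => -[|] ->; rewrite ?scale0r ?scaler0.
have [all_r|/allPn[p pT npr]] :=
    boolP (all (fun p => connect (edge_rel S) p.1 p.2) (eword T)); last first.
  by right; rewrite esubst_ebasis (emon_eq0 (Fn _ _ npr) pT).
left; apply: (gang T) => gT; have [M MT] := chain_gang_consecutive gT.
have RTS : R T \subset R S.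
  apply/subsetP => -[i j]; rewrite !inE /=; apply: connect_sub => x y xy.
  exact: (allP all_r _ xy).
(* With fewer reachable pairs the induction applies to [T]; with equally many, [T] and [S] have the
   same reachability and would coincide. *)
have [lt_R|le_R] := ltnP #|R T| #|R S|.
  by apply: IHm; exact: leq_trans lt_R leRm.
have /eqP ERT : R T == R S by rewrite eqEcard RTS.
have eqR : connect (edge_rel T) =2 connect (edge_rel S).
  by move=> i j; move/setP/(_ (i, j)): ERT; rewrite !inE.
case/eqP: nTS; apply: eword_inj => p; apply/idP/idP.
  by apply: (eword_sub_reach MT) => i j; rewrite eqR.
exact: (eword_sub_reach LS).
Qed.

(* The classes of the monomials e_S, S ranging over chain-gang graphs, form a
   basis of pvb_n^! = ext / ideal: they span modulo the ideal, and are linearly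
   independent modulo the ideal.  Linear combinations of them are written with a
   coefficient function c supported on chain-gang graphs. *)
Theorem theorem5p5 (n : nat) :
  (forall x : ext n, exists c : {ffun {set edge n} -> rat^o},
      (forall S, ~ chain_gang_graph S -> c S = 0) /\
      in_pideal (x - \sum_(S : {set edge n}) c S *: ebasis S))
  /\
  (forall c : {ffun {set edge n} -> rat^o},
      (forall S, ~ chain_gang_graph S -> c S = 0) ->
      in_pideal (\sum_(S : {set edge n}) c S *: ebasis S) ->
      forall S : {set edge n}, c S = 0).
Proof. by split=> [x|]; [exact: gang_span_total | exact: gang_free]. Qed.
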